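(* For the class of all finite simple undirected graphs, computing an $\alpha$-optimal linear reassembling is polynomial-time reducible to computing an $\alpha$-optimal linear arrangement: there is a polynomial-time algorithm which, given a graph $G$ and access to a procedure returning, for any finite simple undirected graph $H$, an $\alpha$-optimal linear arrangement of $H$, outputs an $\alpha$-optimal linear reassembling of $G$.
   Context: Let $G=(V,E)$, $n=|V|$. For $X\subseteq V$, $\deg_G(X)$ is the number of edges with exactly one endpoint in $X$. A linear binary tree over $V$ is a collection $\mathcal{L}=\{\{v_j\}\mid 1\le j\le n\}\cup\{\{v_1,\dots,v_k\}\mid 2\le k\le n\}$ for some enumeration $v_1,\dots,v_n$ of $V$; $(G,\mathcal{L})$ is a linear reassembling of $G$, with $\alpha(G,\mathcal{L})=\max_{X\in\mathcal{L}}\deg_G(X)$; it is $\alpha$-optimal if this value is minimal among all linear reassemblings of $G$. A linear arrangement of $G$ is a bijection $\varphi:V\to\{1,\dots,n\}$ with $\alpha(G,\varphi)=\max_{1\le i\le n}\deg_G(\{v\mid\varphi(v)\le i\})$; it is $\alpha$-optimal if this value is minimal among all linear arrangements of $G$. *)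

(* Defs.v *)
From mathcomp Require Import all_boot all_order all_algebra.

Set Implicit Arguments.
Unset Strict Implicit.
Unset Printing Implicit Defensive.

(** * Simple graphs, linear reassemblings, linear arrangements *)

Record sgraph (V : finType) := SGraph {
  adj :> rel V;
  adj_sym : symmetric adj;
  adj_irr : irreflexive adj }.

Section LinearLayouts.
Variables (V : finType) (G : sgraph V).
Implicit Types (X : {set V}) (L : {set {set V}}).

Definition edges : {set {set V}} :=
  [set e | [exists x, exists y, adj G x y && (e == [set x; y])]].

Definition deg X : nat := #|[set e in edges | #|e :&: X| == 1]|.

(* Positions are 0-based: [v j] is v_(j+1), so that {v_1, ..., v_k} is the set
   of the [v j] with [j < k]. *)
Definition linear_tree (v : 'I_#|V| -> V) : {set {set V}} :=
  [set [set v j] | j : 'I_#|V|]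
  :|: [set [set v j | j : 'I_#|V| & j < k] | k : 'I_#|V|.+1 & 2 <= k].

Definition is_linear_tree L : Prop :=
  exists2 v : 'I_#|V| -> V, bijective v & L = linear_tree v.

Definition alpha_tree L : nat := \max_(X in L) deg X.

Definition optimal_reassembling L : Prop :=
  is_linear_tree L
  /\ forall L', is_linear_tree L' -> alpha_tree L <= alpha_tree L'.

(* An arrangement takes its values in {0, ..., n-1} instead of {1, ..., n}. *)
Definition alpha_arr (phi : V -> 'I_#|V|) : nat :=
  \max_(i < #|V|) deg [set v | phi v <= i].

Definition optimal_arrangement (phi : V -> 'I_#|V|) : Prop :=
  bijective phi
  /\ forall phi' : V -> 'I_#|V|, bijective phi' -> alpha_arr phi <= alpha_arr phi'.

End LinearLayouts.

(** * Deterministic multitape oracle Turing machines *)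

Inductive symbol := Zero | One | Sep.

Definition word := seq symbol.

(* [None] is the blank. *)
Definition cell := option symbol.

(* A two-way infinite tape: [lft] lists the cells to the left of the head,
   nearest first, and [rgt] those to its right; all other cells are blank. *)
Record tape := Tape { lft : seq cell; cur : cell; rgt : seq cell }.

Inductive direction := MoveLeft | MoveRight | Stay.

Definition tape_move (d : direction) (t : tape) : tape :=
  match d with
  | MoveLeft => Tape (behead (lft t)) (head None (lft t)) (cur t :: rgt t)
  | MoveRight => Tape (cur t :: lft t) (head None (rgt t)) (behead (rgt t))
  | Stay => t
  end.

Definition tape_act (a : cell * direction) (t : tape) : tape :=
  tape_move a.2 (Tape (lft t) a.1 (rgt t)).

(* The head is on the first symbol of [w]. *)
Definition tape_of (w : word) : tape :=
  Tape [::] (ohead w) (map Some (behead w)).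

(* The word on a tape: its nonblank symbols, from left to right. *)
Definition tape_word (t : tape) : word :=
  pmap id (rev (lft t) ++ cur t :: rgt t).

Inductive tape_id (k : nat) :=
  InputTape | OutputTape | QueryTape | AnswerTape | WorkTape of 'I_k.
Arguments InputTape {k}.
Arguments OutputTape {k}.
Arguments QueryTape {k}.
Arguments AnswerTape {k}.

(* [ask q = Some q'] makes [q] a query state: in one step the word on the query
   tape is submitted to the oracle, the query tape is erased, the answer tape is
   overwritten with the oracle's reply, and control passes to [q']. *)
Record machine := Machine {
  state : finType;
  start : state;
  final : pred state;
  ask : state -> option state;
  nwork : nat;
  trans : state -> (tape_id nwork -> cell) ->
          state * (tape_id nwork -> cell * direction) }.

Section Semantics.
Variables (M : machine) (O : word -> word).

Definition config : Type := (state M * (tape_id (nwork M) -> tape))%type.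

Definition init (w : word) : config :=
  (start M, fun i => if i is InputTape then tape_of w else tape_of [::]).

Definition step (c : config) : config :=
  let: (q, ts) := c in
  if final q then c
  else if ask q is Some q' then
    (q', fun i => match i with
                  | QueryTape => tape_of [::]
                  | AnswerTape => tape_of (O (tape_word (ts QueryTape)))
                  | _ => ts i
                  end)
  else
    let: (q', a) := trans q (fun i => cur (ts i)) in
    (q', fun i => tape_act (a i) (ts i)).

(* Final configurations are fixed by [step], hence "within [t] steps". *)
Definition outputs_within (w : word) (t : nat) (y : word) : Prop :=
  let c := iter t step (init w) in
  final c.1 /\ tape_word (c.2 OutputTape) = y.

End Semantics.

(** * Search problems and polynomial-time Turing reducibility *)

Record search_problem := SearchProblem {
  instance : Type;
  encode : instance -> word;
  solution : instance -> word -> Prop }.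

(* Nothing is assumed of [O] on words that encode no instance. *)
Definition solves (O : word -> word) (P : search_problem) : Prop :=
  forall x : instance P, solution x (O (encode x)).

(* The machine and its time bound depend neither on the oracle nor on the
   input. *)
Definition poly_time_reducible (P Q : search_problem) : Prop :=
  exists (M : machine) (p : {poly nat}),
  forall O : word -> word, solves O Q ->
  forall x : instance P,
  exists2 y : word,
    outputs_within M O (encode x) (p.[size (encode x)])%R y & solution x y.

(** * The two problems as search problems *)

(* The inputs are the graphs with vertex set {0, ..., n-1}. *)
Definition graph_instance : Type := {n : nat & sgraph 'I_n}.

(* The characteristic vector of [A], closed by a separator. *)
Definition encode_set n (A : {set 'I_n}) : word :=
  rcons [seq if i \in A then One else Zero | i <- enum 'I_n] Sep.

Definition encode_sets n (s : seq {set 'I_n}) : word :=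
  flatten [seq encode_set A | A <- s].

(* The rows of the adjacency matrix. *)
Definition encode_graph (x : graph_instance) : word :=
  let: existT n G := x in
  encode_sets [seq [set j | adj G i j] | i <- enum 'I_n].

(* The table of the values of [phi] shifted to {1, ..., n}, in unary. *)
Definition encode_arr n (phi : 'I_n -> 'I_#|'I_n|) : word :=
  flatten [seq rcons (nseq (phi i).+1 One) Sep | i <- enum 'I_n].

Definition linear_arrangement_problem : search_problem :=
  {| instance := graph_instance;
     encode := encode_graph;
     solution := fun x w => let: existT n G := x in
       exists2 phi, optimal_arrangement G phi & w = encode_arr phi |}.

(* A collection of sets is output as a list, in any order and without
   repetition, of its members. *)
Definition linear_reassembling_problem : search_problem :=
  {| instance := graph_instance;
     encode := encode_graph;
     solution := fun x w => let: existT n G := x in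
       exists2 L, optimal_reassembling G L &
       exists2 s, perm_eq s (enum L) & w = encode_sets s |}.

(* Main.v *)
(** Writing Delta for the maximum degree, alpha(G, L) = max(Delta, alpha(G, phi))
    whenever the linear tree L and the arrangement phi come from the same
    enumeration of the vertices, so an alpha-optimal arrangement of G yields an
    alpha-optimal reassembling.  The machine therefore asks a single question,
    about its own input, and then turns the table of phi into the list of the
    members of L: in round k it overwrites one more [One] in each block
    1^phi(u) # of the answer, and what remains of the block tells whether
    phi(u) < k, phi(u) = k or phi(u) > k, that is, the bit of u in
    {v_1, ..., v_k} and in {v_k}. *)

From HB Require Import structures.
From mathcomp Require Import all_boot all_algebra zify.
Require Import Defs.

Set Implicit Arguments.
Unset Strict Implicit.
Unset Printing Implicit Defensive.

(** * Cost of a linear tree against cost of its arrangement *)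

Section Layouts.
Variables (V : finType) (G : sgraph V).

(** Prefixes of the arrangement have lengths 1 to n, those of the tree 2 to n; the missing one, of
    length 1, is a singleton and so belongs to the tree anyway. *)
Lemma alpha_treeE (v : 'I_#|V| -> V) (phi : V -> 'I_#|V|) :
    cancel v phi -> cancel phi v ->
  alpha_tree G (linear_tree v)
  = maxn (\max_(u : V) deg G [set u]) (alpha_arr G phi).
Proof.
move=> vK phiK.
have prefE k : [set v j | j : 'I_#|V| & j < k] = [set u | phi u < k].
  apply/setP=> u; rewrite inE; apply/imsetP/idP => [[j]|ltk].
    by rewrite inE => ltk ->; rewrite vK.
  by exists (phi u); rewrite ?inE ?phiK.
apply/eqP; rewrite eqn_leq; apply/andP; split.
  apply/bigmax_leqP => X; rewrite inE => /orP[] /imsetP.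
    by case=> j _ ->; rewrite leq_max (leq_bigmax (v j)).
  case=> k; rewrite inE => k_gt1 ->; rewrite prefE leq_max; apply/orP; right.
  (* A prefix of length [k] ends at the 0-based position [k.-1]. *)
  have ltk : k.-1 < #|V| by have := ltn_ord k; lia.
  apply: leq_trans (leq_bigmax (Ordinal ltk)) => /=.
  by have -> : [set u | phi u < k] = [set u | phi u <= k.-1];
    [apply/setP => u; rewrite !inE; lia | exact: leqnn].
rewrite geq_max; apply/andP; split; apply/bigmax_leqP => i _.
  apply: (@leq_bigmax_cond _ (mem (linear_tree v)) (deg G)).
  by rewrite /= inE; apply/orP; left; apply/imsetP; exists (phi i); rewrite ?phiK.
apply: (@leq_bigmax_cond _ (mem (linear_tree v)) (deg G)); rewrite /= inE.
have [i0|i_gt0] := posnP i; apply/orP; [left|right]; apply/imsetP.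
  by exists i => //; apply/setP=> u; rewrite !inE -(can_eq phiK) vK -val_eqE /= i0 leqn0.
exists (Ordinal (ltn_ord i : i.+1 < #|V|.+1)); first by rewrite inE.
by rewrite prefE; apply/setP => u; rewrite !inE.
Qed.

(** The singleton term is common to all linear trees, and inverting the enumeration of a competing
    tree gives a competing arrangement. *)
Lemma optimal_linear_tree (v : 'I_#|V| -> V) (phi : V -> 'I_#|V|) :
    cancel v phi -> cancel phi v -> optimal_arrangement G phi ->
  optimal_reassembling G (linear_tree v).
Proof.
move=> vK phiK [_ phi_min]; split; first by exists v => //; exists phi.
move=> _ [v' [phi' v'K phi'K] ->].
rewrite (alpha_treeE vK phiK) (alpha_treeE v'K phi'K).
have := phi_min phi' (Bijective phi'K v'K); lia.
Qed.

End Layouts.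

(** * The oracle machine *)

Definition bit (b : bool) : symbol := if b then One else Zero.

Inductive phase :=
  Start | Copy | Query | Rewind | Skip | Test | Beyond | Collect | Halt.

Definition nat_of_phase (p : phase) : nat :=
  match p with
  | Start => 0 | Copy => 1 | Query => 2 | Rewind => 3 | Skip => 4
  | Test => 5 | Beyond => 6 | Collect => 7 | Halt => 8
  end.

Definition ord_of_phase (p : phase) : 'I_9 := inord (nat_of_phase p).

Definition phase_of_ord (i : 'I_9) : phase :=
  nth Start [:: Start; Copy; Query; Rewind; Skip; Test; Beyond; Collect; Halt] i.

Lemma ord_of_phaseK : cancel ord_of_phase phase_of_ord.
Proof. by case; rewrite /phase_of_ord /ord_of_phase inordK. Qed.

HB.instance Definition _ := Finite.copy phase (can_type ord_of_phaseK).

Definition layout_state : Type := (phase * bool * bool)%type.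

Definition action : Type := (cell * direction)%type.

Definition emit (s : symbol) : action := (Some s, MoveRight).
(** Writing a blank is harmless on the output tape, whose head always rests on the blank cell after
    the written word. *)
Definition idle : action := (None, Stay).
Definition emit_if (b : bool) (s : symbol) : action := if b then emit s else idle.

(* In [(ph, b, f)], [b] is false only during the first round, whose prefix {v_1}
   must not be repeated, and [f] records that some block of the current round has
   a value beyond the round number, so that another round is needed.  Prefixes go
   to the output tape; singletons go to the query tape, each preceded by [Sep],
   and [Collect] copies them backwards to the output tape. *)
Definition delta (q : layout_state) (i y a : cell) :
    layout_state * action * action * action * action :=
  let: (ph, b, f) := q in
  match ph with
  | Start =>
      (if i is Some _ then Copy else Halt, b, f, (i, Stay), idle, (y, Stay), (a, Stay))
  | Copy =>
      if i is Some s then (Copy, b, f, (i, MoveRight), idle, emit s, (a, Stay))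
      else (Query, b, f, (i, Stay), idle, (y, Stay), (a, Stay))
  | Rewind =>
      if a is Some _ then (Rewind, b, f, (i, Stay), idle, (y, Stay), (a, MoveLeft))
      else (Skip, b, false, (i, Stay), idle, emit Sep, (a, MoveRight))
  | Skip =>
      match a with
      | Some Zero => (Skip, b, f, (i, Stay), idle, (y, Stay), (a, MoveRight))
      | Some One => (Test, b, f, (i, Stay), idle, (y, Stay), emit Zero)
      | Some Sep => (Skip, b, f, (i, Stay), emit_if b One, emit Zero, (a, MoveRight))
      | None =>
          if f then (Rewind, true, f, (i, Stay), emit_if b Sep, (y, Stay), (a, MoveLeft))
          else (Collect, b, f, (i, Stay), emit_if b Sep, (y, MoveLeft), (a, Stay))
      end
  | Test =>
      if a is Some Sep then
        (Skip, b, f, (i, Stay), emit_if b One, emit One, (a, MoveRight))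
      else (Beyond, b, true, (i, Stay), idle, (y, Stay), (a, MoveRight))
  | Beyond =>
      if a is Some Sep then
        (Skip, b, f, (i, Stay), emit_if b Zero, emit Zero, (a, MoveRight))
      else (Beyond, b, f, (i, Stay), idle, (y, Stay), (a, MoveRight))
  | Collect =>
      if y is Some s then (Collect, b, f, (i, Stay), emit s, (y, MoveLeft), (a, Stay))
      else (Halt, b, f, (i, Stay), idle, (y, Stay), (a, Stay))
  | _ => (q, (i, Stay), idle, (y, Stay), (a, Stay))
  end.

Arguments delta : simpl never.

Definition layout_machine : machine :=
  {| state := layout_state;
     start := (Start, false, false);
     final := fun q => if q.1.1 is Halt then true else false;
     ask := fun q => if q.1.1 is Query then Some (Rewind, false, false) else None;
     nwork := 0;
     trans := fun q rd =>
       let: (q', ai, ao, ay, aa) :=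
         delta q (rd InputTape) (rd QueryTape) (rd AnswerTape) in
       (q', fun i => match i with
                     | InputTape => ai
                     | OutputTape => ao
                     | QueryTape => ay
                     | AnswerTape => aa
                     | WorkTape _ => idle
                     end) |}.

(** * Simulation of the machine by explicit four-tape snapshots *)

Record snapshot :=
  Snap { s_st : layout_state; s_in : tape; s_out : tape; s_qry : tape; s_ans : tape }.

Lemma cat_nseq_cons (T : Type) m (x : T) l :
  nseq m x ++ x :: l = x :: nseq m x ++ l.
Proof. by elim: m => //= m ->. Qed.

Section Run.
Variable O : word -> word.

Definition snap_step (x : snapshot) : snapshot :=
  let: Snap q ti to ty ta := x in
  match q.1.1 with
  | Halt => x
  | Query => Snap (Rewind, false, false) ti to (tape_of [::]) (tape_of (O (tape_word ty)))
  | _ =>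
    let: (q', ai, ao, ay, aa) := delta q (cur ti) (cur ty) (cur ta) in
    Snap q' (tape_act ai ti) (tape_act ao to) (tape_act ay ty) (tape_act aa ta)
  end.

(** The tapes of a configuration form a function of the tape index; comparing them one by one avoids
    equality of functions. *)
Definition shows (c : config layout_machine) (x : snapshot) : Prop :=
  c.1 = s_st x /\ [/\ c.2 InputTape = s_in x, c.2 OutputTape = s_out x,
                      c.2 QueryTape = s_qry x & c.2 AnswerTape = s_ans x].

Lemma shows_step c x : shows c x -> shows (step O c) (snap_step x).
Proof.
case: c x => [q ts] [q' ti to ty ta] [/= -> [<- <- <- <-]].
case: q' => [[[] b] f]; rewrite /shows /snap_step /step //.
all: by rewrite /=; case: delta => [[[[]]]].
Qed.

Lemma shows_iter t c x : shows c x -> shows (iter t (step O) c) (iter t snap_step x).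
Proof. by move=> cx; elim: t => //= t IH; apply: shows_step. Qed.

Lemma iter_chain m n x y z :
  iter m snap_step x = y -> iter n snap_step y = z -> iter (m + n) snap_step x = z.
Proof. by rewrite addnC iterD => -> ->. Qed.

(* Trailing blanks are significant in [tape]; [tp l r] has its head on the
   first cell of [r], or on a blank when [r] is empty. *)
Definition tp (l r : seq cell) : tape := Tape l (head None r) (behead r).

Definition otape (w : word) : tape := tp (map Some (rev w)) [::].

Lemma emit_otape w s : tape_act (emit s) (otape w) = otape (rcons w s).
Proof. by rewrite /otape rev_rcons. Qed.

Lemma emit_if_otape b w s :
  tape_act (emit_if b s) (otape w) = otape (w ++ if b then [:: s] else [::]).
Proof. by case: b; rewrite ?cats0 // cats1 -emit_otape. Qed.

Lemma pmap_Some (w : word) : pmap id (map Some w) = w.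
Proof. by elim: w => //= s w ->. Qed.

Lemma tape_word_otape w : tape_word (otape w) = w.
Proof. by rewrite /tape_word /= -map_rev revK pmap_cat pmap_Some cats0. Qed.

(** * Single sweeps and single blocks *)

Lemma run_copy b f o l y w ta :
  iter (size w).+1 snap_step
    (Snap (Copy, b, f) (tp l (map Some w)) (otape o) (otape y) ta)
  = Snap (Query, b, f) (tp (map Some (rev w) ++ l) [::]) (otape o) (otape (y ++ w)) ta.
Proof.
case: ta => al ac ar; elim: w l y => [|s w IH] l y; first by rewrite cats0.
rewrite [size _]/= iterSr rev_cons map_rcons cat_rcons -[y ++ _]cat_rcons -IH.
by congr iter; rewrite -emit_otape.
Qed.

Lemma run_collect b f ti o l r ta :
  exists ty, iter (size l).+1 snap_step
    (Snap (Collect, b, f) ti (otape o)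
       (tp (behead (map Some l)) (head None (map Some l) :: r)) ta)
  = Snap (Halt, b, f) ti (otape (o ++ l)) ty ta.
Proof.
case: ti => il ic ir; case: ta => al ac ar.
elim: l o r => [|s l IH] o r; first by rewrite cats0; eexists.
have [ty IHs] := IH (rcons o s) (Some s :: r); exists ty.
rewrite [size _]/= iterSr -[o ++ _]cat_rcons -IHs.
by congr iter; rewrite -emit_otape.
Qed.

(** Here [z] is [[::]] on a fresh answer tape, never visited left of its first cell, and [[:: None]]
    in later rounds; both lead to the same tape, with one explicit blank on the left. *)
Lemma run_rewind b f ti o y l r z :
    head None z = None -> behead z = [::] ->
  iter (size l).+1 snap_step
    (Snap (Rewind, b, f) ti (otape o) (otape y)
       (tp (behead (map Some l ++ z)) (head None (map Some l ++ z) :: r)))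
  = Snap (Skip, b, false) ti (otape o) (otape (rcons y Sep))
      (tp [:: None] (map Some (rev l) ++ r)).
Proof.
case: ti => il ic ir z0 z_nil; elim: l r => [|s l IH] r.
  by rewrite -emit_otape /= z0 z_nil.
rewrite [size _]/= iterSr rev_cons map_rcons cat_rcons -IH.
by congr iter.
Qed.

Lemma run_skip_zeros b f ti o y l m r :
  iter m snap_step
    (Snap (Skip, b, f) ti (otape o) (otape y) (tp l (nseq m (Some Zero) ++ r)))
  = Snap (Skip, b, f) ti (otape o) (otape y) (tp (nseq m (Some Zero) ++ l) r).
Proof.
case: ti => il ic ir; elim: m l => //= m IH l.
by rewrite -iterS iterSr /= IH cat_nseq_cons.
Qed.

Lemma run_beyond_ones b f ti o y l m r :
  iter m snap_step
    (Snap (Beyond, b, f) ti (otape o) (otape y) (tp l (nseq m (Some One) ++ r)))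
  = Snap (Beyond, b, f) ti (otape o) (otape y) (tp (nseq m (Some One) ++ l) r).
Proof.
case: ti => il ic ir; elim: m l => //= m IH l.
by rewrite -iterS iterSr /= IH cat_nseq_cons.
Qed.

(* The block of an answer value [p] after [k] rounds, each of which overwrites
   the leftmost remaining [One] of every block. *)
Definition block (k p : nat) : word :=
  nseq (minn k p) Zero ++ nseq (p - k) One ++ [:: Sep].

Lemma size_block k p : size (block k p) = p.+1.
Proof. by rewrite !size_cat !size_nseq /=; lia. Qed.

(** The head crosses each of the [p.+1] cells once. If [p <= k], no [One] is left. If [p = k.+1],
    the erased [One] is the last and [Test] meets [Sep]. Otherwise [Test] meets another [One], and
    [Beyond] runs through the rest with [f] set. *)
Lemma run_block b f ti o y l k p r :
  iter p.+1 snap_step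
    (Snap (Skip, b, f) ti (otape o) (otape y) (tp l (map Some (block k p) ++ r)))
  = Snap (Skip, b, f || (k.+1 < p)) ti
      (otape (o ++ if b then [:: bit (p <= k.+1)] else [::]))
      (otape (rcons y (bit (p == k.+1))))
      (tp (map Some (rev (block k.+1 p)) ++ l) r).
Proof.
case: ti => il ic ir.
rewrite /block !rev_cat !rev_nseq !map_cat !map_nseq -!catA.
case: (ltngtP p k.+1) => [le_pk|lt_kp|->].
- have [-> -> ->] : [/\ minn k p = p, p - k = 0 & p - k.+1 = 0].
    by split; lia.
  rewrite -addn1; apply: iter_chain; first exact: run_skip_zeros.
  by rewrite -emit_otape -emit_if_otape orbF.
- have [-> ->] : minn k p = k /\ p - k = (p - k.+2).+2.
    by split; lia.
  have -> : p - k.+1 = (p - k.+2).+1 by lia.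
  have -> : p.+1 = k + (2 + (p - k.+2 + 1)) by lia.
  apply: iter_chain; first exact: run_skip_zeros.
  apply: iter_chain; first by [].
  apply: iter_chain; first exact: run_beyond_ones.
  rewrite -emit_otape -emit_if_otape orbT.
  by congr Snap; rewrite /tp /= cat_nseq_cons.
have [-> -> ->] : [/\ minn k k.+1 = k, k.+1 - k = 1 & k.+1 - k.+1 = 0].
  by split; lia.
have -> : k.+2 = k + 2 by lia.
apply: iter_chain; first exact: run_skip_zeros.
by rewrite -emit_otape -emit_if_otape orbF.
Qed.

(** * Rounds over the whole answer, and the complete run *)

Definition blocks (k : nat) (ps : seq nat) : word := flatten [seq block k p | p <- ps].

Lemma blocks_cons k p ps : blocks k (p :: ps) = block k p ++ blocks k ps.
Proof. by []. Qed.

Lemma size_blocks k ps : size (blocks k ps) = sumn [seq p.+1 | p <- ps].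
Proof. by elim: ps => //= p ps IH; rewrite size_cat size_block IH. Qed.

Lemma run_blocks b f ti o y l k ps r :
  iter (size (blocks k ps)) snap_step
    (Snap (Skip, b, f) ti (otape o) (otape y) (tp l (map Some (blocks k ps) ++ r)))
  = Snap (Skip, b, f || has (leq k.+2) ps) ti
      (otape (o ++ if b then [seq bit (p <= k.+1) | p <- ps] else [::]))
      (otape (y ++ [seq bit (p == k.+1) | p <- ps]))
      (tp (map Some (rev (blocks k.+1 ps)) ++ l) r).
Proof.
elim: ps f o y l => [|p ps IH] f o y l.
  by rewrite /= orbF !cats0; case: b; rewrite ?cats0.
rewrite blocks_cons size_cat size_block map_cat -catA.
apply: iter_chain; first exact: run_block.
rewrite IH blocks_cons [rev (_ ++ _)]rev_cat (map_cat Some) -!catA cat_rcons -orbA.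
by case: b {IH}.
Qed.

Definition prefix_word (ps : seq nat) (k : nat) : word :=
  rcons [seq bit (p <= k) | p <- ps] Sep.

(** The leading [Sep] becomes the closing one when [Collect] reverses the word. *)
Definition singleton_word (ps : seq nat) (k : nat) : word :=
  Sep :: [seq bit (p == k) | p <- ps].

Lemma run_stop b ti o y l r : head None r = None -> behead r = [::] ->
  iter 1 snap_step (Snap (Skip, b, false) ti (otape o) (otape y) (tp l r))
  = Snap (Collect, b, false) ti (otape (o ++ if b then [:: Sep] else [::]))
      (tape_move MoveLeft (otape y)) (tp l [::]).
Proof. by case: ti => ? ? ? r0 r_nil; rewrite -emit_if_otape /tp r0 r_nil. Qed.

Lemma run_turn b ti o y l r : head None r = None -> behead r = [::] ->
  iter 1 snap_step (Snap (Skip, b, true) ti (otape o) (otape y) (tp l r))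
  = Snap (Rewind, true, true) ti (otape (o ++ if b then [:: Sep] else [::]))
      (otape y) (tp (behead l) [:: head None l; None]).
Proof. by case: ti => ? ? ? r0 r_nil; rewrite -emit_if_otape /tp r0 r_nil. Qed.

(** The last hypothesis says that the largest value is [k + m.+1], so [m] rounds follow the current
    one. A round with a successor costs [A] steps forward, one to turn and [A.+1] to rewind; the
    last costs [A] and one to stop. Blocks keep their size, so [A] can be taken at round 0. *)
Lemma run_rounds m k b ti o y ps r :
    head None r = None -> behead r = [::] ->
    (forall j, has (leq j.+1) ps = (j < k + m.+1)) ->
  exists b' ta,
  let A := size (blocks 0 ps) in
  iter (m * (A + A.+2) + A.+1) snap_step
    (Snap (Skip, b, false) ti (otape o) (otape (rcons y Sep))
       (tp [:: None] (map Some (blocks k ps) ++ r)))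
  = Snap (Collect, b', false) ti
      (otape (o ++ (if b then prefix_word ps k.+1 else [::])
                ++ flatten [seq prefix_word ps j | j <- iota k.+2 m]))
      (tape_move MoveLeft
         (otape (y ++ flatten [seq singleton_word ps j | j <- iota k.+1 m.+1])))
      ta.
Proof.
elim: m k b o y r => [|m IH] k b o y r r0 r_nil max_ps.
  exists b; eexists; cbv zeta; rewrite mul0n add0n (size_blocks 0) -(size_blocks k) -addn1.
  apply: iter_chain; first exact: run_blocks.
  rewrite max_ps addn1 ltnn run_stop // cat_rcons -catA [flatten (map _ (iota k.+1 _))]/= !cats0.
  by case: b; rewrite /prefix_word -?cats1 ?cats0.
have [|b' [ta]] := IH k.+1 true (o ++ if b then prefix_word ps k.+1 else [::])
  (y ++ singleton_word ps k.+1) [:: None] erefl erefl _.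
  by move=> j; rewrite max_ps addSnnS.
set A := size _ => IHm; exists b', ta; cbv zeta.
have -> : m.+1 * (A + A.+2) + A.+1 = A + (1 + (A.+1 + (m * (A + A.+2) + A.+1))) by lia.
have sz j : A = size (blocks j ps) by rewrite /A !size_blocks.
apply: iter_chain; first by rewrite (sz k); apply: run_blocks.
(* Some value exceeds [k.+1], so this round ends with [f] set and the machine turns back. *)
rewrite max_ps (_ : k.+1 < k + m.+2 = true); last by lia.
apply: iter_chain; first exact: run_turn.
apply: iter_chain.
  by rewrite (sz k.+1) -size_rev; apply: (@run_rewind _ _ _ _ _ _ [:: None] [:: None]).
rewrite revK -!catA in IHm *; rewrite cat_rcons.
rewrite [iota k.+1 _]/= [iota k.+2 _]/= ![flatten (map _ (_ :: _))]/= -IHm.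
congr (iter _ _ (Snap _ _ (otape _) _ _)).
by case: b {IHm} => //; rewrite /prefix_word -cats1.
Qed.

Lemma run_machine m ps w :
    w <> [::] -> O w = blocks 0 ps -> (forall j, has (leq j.+1) ps = (j < m.+1)) ->
  let A := size (blocks 0 ps) in
  exists b ti ty ta,
  iter (size w + m * (A + A.+2) + A + m.+1 * (size ps).+1 + 7) snap_step
    (Snap (Start, false, false) (tape_of w) (otape [::]) (otape [::]) (otape [::]))
  = Snap (Halt, b, false) ti
      (otape (flatten [seq prefix_word ps j | j <- iota 2 m]
              ++ rev (flatten [seq singleton_word ps j | j <- iota 1 m.+1]))) ty ta.
Proof.
move=> w_neq0 Ow max_ps A.
(* The answer is nonempty because [max_ps] at 0 yields an entry of [ps]. The first rewind starts on
   its first cell [s], hence takes two steps. *)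
have [s [v bE]] : exists s v, blocks 0 ps = s :: v.
  case: ps max_ps {Ow A} => [/(_ 0)//|p ps _].
  by case: (blocks _ _) (size_blocks 0 (p :: ps)) => // s v _; exists s, v.
set yy := flatten [seq singleton_word ps j | j <- iota 1 m.+1].
have szy : size yy = m.+1 * (size ps).+1.
  rewrite /yy -{2}(size_iota 1 m.+1); elim: (iota _ _) => // j js IH.
  by rewrite map_cons [size (flatten _)]size_cat IH /= size_map.
have [b' [ta rounds]] := @run_rounds m 0 false (tp (map Some (rev w) ++ [::]) [::]) [::] [::] ps [::] erefl erefl max_ps.
have [ty collect] := run_collect b' false (tp (map Some (rev w) ++ [::]) [::])
  ([::] ++ [::] ++ flatten [seq prefix_word ps j | j <- iota 2 m]) (rev yy) [:: None] ta.
exists b', (tp (map Some (rev w) ++ [::]) [::]), ty, ta.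
rewrite -szy.
(* The summands are the start, the copy of the input, the query, the first rewind, the rounds and
   the collection. *)
have -> : size w + m * (A + A.+2) + A + size yy + 7 =
  1 + ((size w).+1 + (1 + (2 + ((m * (A + A.+2) + A.+1) + (size (rev yy)).+1)))).
  by rewrite size_rev; lia.
apply: iter_chain.
  rewrite (_ : iter 1 _ _ = Snap (Copy, false, false) (tp [::] (map Some w)) (otape [::]) (otape [::]) (otape [::])) //.
  by case: w w_neq0 {Ow rounds collect}.
apply: iter_chain; first exact: run_copy.
apply: iter_chain.
  by rewrite /= tape_word_otape Ow bE.
apply: iter_chain; first exact: (@run_rewind _ _ _ _ [::] [:: s] (map Some v) [::]).
apply: iter_chain; last exact: collect.
by rewrite -rounds /A bE !cats0.
Qed.

End Run.

(** * The list of sets spelled by the output *)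

Lemma size_encode_sets n (s : seq {set 'I_n}) : size (encode_sets s) = size s * n.+1.
Proof.
elim: s => // A s IH.
by rewrite /encode_sets map_cons size_cat IH size_rcons size_map -cardE card_ord.
Qed.

(** Turns a characteristic vector read backwards into that of the mirrored set. *)
Lemma rev_enum_ord n : rev (enum 'I_n) = map (@rev_ord n) (enum 'I_n).
Proof.
apply: (inj_map val_inj); rewrite map_rev val_enum_ord -map_comp.
rewrite (@eq_map _ _ _ ((fun i => n - i.+1) \o val)) // map_comp val_enum_ord.
apply: (@eq_from_nth _ 0) => [|i]; rewrite size_rev ?size_map // size_iota => lt_in.
rewrite nth_rev ?size_iota // (nth_map 0) ?size_iota // !nth_iota ?add0n //; lia.
Qed.

Lemma sumn_le (b : nat) (s : seq nat) : all (leq^~ b) s -> sumn s <= size s * b.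
Proof. by elim: s => //= a s IH /andP[le_ab /IH]; rewrite mulSn; apply: leq_add. Qed.

Section Output.
Variables (n : nat) (v : 'I_#|'I_n| -> 'I_n) (phi : 'I_n -> 'I_#|'I_n|).
Hypotheses (vK : cancel v phi) (phiK : cancel phi v).

Let values : seq nat := [seq (phi i).+1 | i <- enum 'I_n].

Definition prefix_set (k : nat) : {set 'I_n} := [set u | phi u < k].

(* The machine writes the characteristic vectors of the singletons backwards,
   which merely permutes the singletons. *)
Definition mirror_set (k : nat) : {set 'I_n} := [set u | (phi (rev_ord u)).+1 == k].

Definition tree_list : seq {set 'I_n} :=
  [seq prefix_set k | k <- iota 2 n.-1] ++ rev [seq mirror_set k | k <- iota 1 n].

Lemma phi_lt u : phi u < n.
Proof. by rewrite -[X in _ < X]card_ord. Qed.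

Lemma phi_onto k : k < n -> exists u, phi u = k :> nat.
Proof.
rewrite -{1}[n]card_ord => lt_k; exists (v (Ordinal lt_k)); by rewrite vK.
Qed.

Lemma encode_arrE : encode_arr phi = blocks 0 values.
Proof.
rewrite /encode_arr /blocks /values -map_comp; congr flatten; apply: eq_map => i /=.
by rewrite /block min0n subn0 cats1.
Qed.

Lemma has_values j : has (leq j.+1) values = (j < n).
Proof.
rewrite has_map; apply/hasP/idP => [[u _ /=]|lt_jn].
  by have := phi_lt u; lia.
have [u phi_u] := phi_onto lt_jn.
by exists u; rewrite ?mem_enum //= phi_u.
Qed.

Lemma encode_prefix_set k : encode_set (prefix_set k) = prefix_word values k.
Proof.
by rewrite /encode_set /prefix_word /values -map_comp; congr rcons; apply: eq_map => u; rewrite inE.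
Qed.

Lemma encode_mirror_set k : encode_set (mirror_set k) = rev (singleton_word values k).
Proof.
rewrite rev_cons /values -2!map_rev rev_enum_ord -2!map_comp; congr rcons.
by apply: eq_map => u; rewrite inE.
Qed.

Lemma encode_tree_list :
  encode_sets tree_list
  = flatten [seq prefix_word values k | k <- iota 2 n.-1]
    ++ rev (flatten [seq singleton_word values k | k <- iota 1 n]).
Proof.
rewrite /encode_sets map_cat flatten_cat map_rev rev_flatten -!map_comp.
by congr (flatten _ ++ flatten (rev _)); apply: eq_map => k /=;
  rewrite ?encode_prefix_set ?encode_mirror_set.
Qed.

Lemma uniq_tree_list : uniq tree_list.
Proof.
(* The vertex at 0-based position [k] lies in the longer prefix only; [k' <= n] ensures that it
   exists. *)
have pref_inj k k' : k < k' -> k' <= n -> prefix_set k <> prefix_set k'.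
  move=> lt_kk' le_k'n; have [|u phi_u] := @phi_onto k; first by lia.
  by move/setP/(_ u); rewrite !inE phi_u ltnn lt_kk'.
rewrite cat_uniq rev_uniq; apply/and3P; split.
- rewrite map_inj_in_uniq ?iota_uniq // => k k'; rewrite !mem_iota => k_in k'_in eq_kk'.
  case: (ltngtP k k') => // lt_k; last move: eq_kk' => /esym eq_kk'.
    by case: (pref_inj _ _ lt_k _ eq_kk'); lia.
  by case: (pref_inj _ _ lt_k _ eq_kk'); lia.
- apply/hasPn => X; rewrite mem_rev => /mapP[j _ ->] /=.
  apply/mapP => -[k]; rewrite mem_iota => k_in /setP eqX.
  (* Since [k >= 2], the prefix contains the vertices at positions 0 and 1, whereas a mirrored set
     has at most one member. *)
  have [|u0 phi_u0] := @phi_onto 0; first by lia.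
  have [|u1 phi_u1] := @phi_onto 1; first by lia.
  have := eqX u0; have := eqX u1; rewrite !inE phi_u0 phi_u1.
  have [-> ->] : 0 < k /\ 1 < k by lia.
  move=> /eqP <- /eqP [] /val_inj /(can_inj phiK) /rev_ord_inj u01.
  by rewrite u01 phi_u1 in phi_u0.
rewrite map_inj_in_uniq ?iota_uniq // => k k'; rewrite !mem_iota => k_in k'_in /setP eq_kk'.
have [|u phi_u] := @phi_onto k.-1; first by lia.
have := eq_kk' (rev_ord u); rewrite !inE rev_ordK phi_u; lia.
Qed.

Lemma mem_tree_list : tree_list =i linear_tree v.
Proof.
have prefE k : prefix_set k = [set v j | j : 'I_#|'I_n| & j < k].
  apply/setP=> u; rewrite inE; apply/idP/imsetP => [ltk|[j]].
    by exists (phi u); rewrite ?inE ?phiK.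
  by rewrite inE => ltk ->; rewrite vK.
(* Mirroring permutes the vertices, so the mirrored sets still run through all singletons. *)
have mirrorE u : mirror_set (phi (rev_ord u)).+1 = [set u].
  apply/setP=> u'; rewrite !inE eqSS.
  by rewrite (inj_eq val_inj) (can_eq phiK) (inj_eq rev_ord_inj).
move=> X; rewrite mem_cat mem_rev inE orbC; congr orb; apply/mapP/imsetP.
- case=> k; rewrite mem_iota => k_in ->.
  have [|u phi_u] := @phi_onto k.-1; first by lia.
  exists (phi (rev_ord u)) => //; rewrite phiK -mirrorE rev_ordK phi_u.
  by congr mirror_set; lia.
- case=> j _ ->; exists (phi (rev_ord (v j))).+1; last by rewrite mirrorE.
  by rewrite mem_iota; have := phi_lt (rev_ord (v j)); lia.
- case=> k; rewrite mem_iota => k_in ->.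
  have ltk : k < #|'I_n|.+1 by rewrite card_ord; lia.
  by exists (Ordinal ltk); rewrite ?inE ?prefE //=; lia.
case=> k; rewrite inE => k_gt1 ->; exists (k : nat); last by rewrite prefE.
by have := ltn_ord k; rewrite [X in _ < X.+1]card_ord mem_iota; lia.
Qed.

End Output.

(** * Correctness and the polynomial time bound *)

Lemma iter_final (M : machine) O (c : config M) t t' :
    t <= t' -> final (iter t (step O) c).1 ->
  iter t' (step O) c = iter t (step O) c.
Proof.
move=> /subnK <- fin; rewrite iterD; elim: (t' - t) => //= d ->.
by case: (iter t _ c) fin => q ts /= fin; rewrite fin.
Qed.

Theorem theorem4p9 :
  poly_time_reducible linear_reassembling_problem linear_arrangement_problem.
Proof.
(* With [N] the input size and [A] the answer size, a run takes [N + (n-1)(2A+2) + A + n(n+1) + 7]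
   steps. Here [n(n+1) = N], [A <= N] and [n <= N], whence [2N^2 + 5N + 7]. *)
exists layout_machine, (2%N%:P * 'X^2 + 5%N%:P * 'X + 7%N%:P)%R => O O_solves [n G].
pose w := encode_graph (existT _ n G); rewrite -[encode _]/w.
have [phi phi_opt Ow] : exists2 phi, optimal_arrangement G phi & O w = encode_arr phi.
  exact: O_solves (existT _ n G).
have [[v phiK vK] _] := phi_opt.
have size_w : size w = n * n.+1.
  by rewrite size_encode_sets size_map -cardE card_ord.
exists (encode_sets (tree_list phi)); last first.
  exists (linear_tree v); first exact: (optimal_linear_tree vK phiK).
  exists (tree_list phi) => //; apply: uniq_perm; rewrite ?enum_uniq //.
    exact: (uniq_tree_list vK phiK).
  by move=> X; rewrite mem_enum; apply: (mem_tree_list vK phiK).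
suff [t le_t [b [ti [ty [ta run]]]]] : exists2 t, t <= 2 * size w ^ 2 + 5 * size w + 7 &
    exists b ti ty ta, iter t (snap_step O)
      (Snap (Start, false, false) (tape_of w) (otape [::]) (otape [::]) (otape [::]))
    = Snap (Halt, b, false) ti (otape (encode_sets (tree_list phi))) ty ta.
  have [] := @shows_iter O t (init layout_machine w)
    (Snap (Start, false, false) (tape_of w) (otape [::]) (otape [::]) (otape [::])).
    by [].
  rewrite run /= => q_halt [_ out _ _].
  rewrite /outputs_within (@iter_final _ _ _ t) ?q_halt ?out ?tape_word_otape //.
  by rewrite !(hornerD, hornerCM, hornerC, hornerXn, hornerX).
(* The empty graph has an empty encoding: [Start] halts in one step, and the empty output encodes
   the empty tree. *)
have [n0|n_gt0] := posnP n.
  have w_nil : w = [::] by apply: size0nil; rewrite size_w n0.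
  exists 1 => //; rewrite w_nil; do 4 eexists; rewrite /tree_list; subst n; reflexivity.
have w_cons : w <> [::] by move=> w_nil; have := size_w; rewrite w_nil /=; lia.
rewrite encode_tree_list; pose ps := [seq (phi i).+1 | i <- enum 'I_n]; rewrite -/ps.
have size_ps : size ps = n by rewrite /ps size_map size_enum_ord.
(* Each of the [n] blocks holds a value at most [n] and one separator, so [A] is at most
   [n * n.+1]. *)
have le_A : size (blocks 0 ps) <= size w.
  rewrite size_blocks size_w -{1}size_ps -(size_map S); apply: sumn_le.
  by rewrite all_map all_map; apply/allP => u _ /=; rewrite ltnS phi_lt.
have Ow_blocks : O w = blocks 0 ps by rewrite Ow encode_arrE.
have := @run_machine O n.-1 ps w w_cons Ow_blocks.
rewrite (prednK n_gt0) => /(_ (has_values vK)) run; eexists; last exact: run.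
rewrite size_ps -size_w -mulnn.
have : n <= size w by rewrite size_w; lia.
move: (size _) le_A => A; nia.
Qed.
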